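(* Let $\mathcal{C}$ be a braided monoidal category and let $\overline{\mathcal{C}}$ be its strictification. Then $\mathrm{ZI}(\mathcal{C})\cong\mathrm{ZI}(\overline{\mathcal{C}})$ as meet-semilattices.
   Context: Unitors are $\lambda_A:I\otimes A\to A$, $\rho_A:A\otimes I\to A$, associators $\alpha_{ABC}:(A\otimes B)\otimes C\to A\otimes(B\otimes C)$; an object's name also denotes its identity morphism. A half-braiding on an object $U$ of a monoidal category is a natural isomorphism $\sigma_A:U\otimes A\to A\otimes U$ with $\sigma_{A\otimes B}=\alpha^{-1}_{ABU}\circ(A\otimes\sigma_B)\circ\alpha_{AUB}\circ(\sigma_A\otimes B)\circ\alpha^{-1}_{UAB}$. The center $\mathcal{Z}(\mathcal{C})$ has objects $(U,\sigma)$ and morphisms $(U,\sigma)\to(V,\tau)$ those $f:U\to V$ with $\tau_A\circ(f\otimes A)=(A\otimes f)\circ\sigma_A$ for all $A$. A central idempotent is a morphism $u:(U,\sigma)\to(I,\rho^{-1}\circ\lambda)$ in $\mathcal{Z}(\mathcal{C})$ such that $\lambda_U\circ(u\otimes U)=\rho_U\circ(U\otimes u)$ and this morphism $U\otimes U\to U$ is invertible. Two central idempotents are identified if they are isomorphic in $\mathcal{Z}(\mathcal{C})/I$, and $u\le v$ if there is a morphism $u\to v$ in $\mathcal{Z}(\mathcal{C})/I$. $\mathrm{ZI}(\mathcal{C})$ is the resulting partially ordered collection; it is a meet-semilattice with top $\mathrm{id}_I$ and meet $u\wedge v=\lambda_I\circ(u\otimes v)$. The strictification $\overline{\mathcal{C}}$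 is the strict braided monoidal category whose objects are finite sequences of objects of $\mathcal{C}$, whose tensor product on objects is concatenation (unit the empty sequence), whose morphisms $S\to T$ are the morphisms in $\mathcal{C}$ between the (left-bracketed) tensor products of the sequences, and whose tensor product of morphisms and braiding are transported from $\mathcal{C}$ along the coherence isomorphisms; there is a canonical strong braided monoidal equivalence $\mathcal{C}\to\overline{\mathcal{C}}$ sending an object to the corresponding one-term sequence. *)

(* Defs.v *)
From HB Require Import structures.
From mathcomp Require Import all_boot all_order.
From mathcomp Require Import generic_quotient boolp.

Set Implicit Arguments.
Unset Strict Implicit.
Unset Printing Implicit Defensive.

Declare Scope cat_scope.
Delimit Scope cat_scope with cat.
Local Open Scope quotient_scope.
Local Open Scope cat_scope.

Reserved Notation "A \ox B" (at level 40, left associativity).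
Reserved Notation "f \ot g" (at level 40, left associativity).

Record Category := MkCategory {
  Ob :> Type;
  Hom : Ob -> Ob -> Type;
  idm : forall A : Ob, Hom A A;
  compm : forall A B C : Ob, Hom B C -> Hom A B -> Hom A C;
  compA : forall A B C D (h : Hom C D) (g : Hom B C) (f : Hom A B),
    compm h (compm g f) = compm (compm h g) f;
  comp1m : forall A B (f : Hom A B), compm (idm B) f = f;
  compm1 : forall A B (f : Hom A B), compm f (idm A) = f
}.

Arguments Hom {c} A B : rename.
Arguments idm {c} A : rename.
Arguments compm {c A B C} g f : rename.

Notation "g \o f" := (compm g f) : cat_scope.

Record iso (K : Category) (A B : K) := MkIso {
  isom :> Hom A B;
  isoinv : Hom B A;
  isoK : isoinv \o isom = idm A;
  isoVK : isom \o isoinv = idm B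
}.

Notation "f ^-1" := (isoinv f) : cat_scope.

Definition is_iso (K : Category) (A B : K) (f : Hom A B) : Prop :=
  exists g : Hom B A, g \o f = idm A /\ f \o g = idm B.

Definition isomorphic (K : Category) (A B : K) : Prop :=
  exists f : Hom A B, is_iso f.

Section Isos.
Variable K : Category.

Definition iso_id (A : K) : iso A A :=
  MkIso (comp1m (idm A)) (comp1m (idm A)).

Definition iso_sym (A B : K) (f : iso A B) : iso B A :=
  MkIso (isoVK f) (isoK f).

Lemma iso_comp_subproof (A B C : K) (g : iso B C) (f : iso A B) :
  (f^-1 \o g^-1) \o (g \o f) = idm A /\ (g \o f) \o (f^-1 \o g^-1) = idm C.
Proof.
by split; [rewrite compA -(compA _ _ g) isoK compm1 isoK
          |rewrite compA -(compA _ _ (f^-1)) isoVK compm1 isoVK].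
Qed.

Definition iso_comp (A B C : K) (g : iso B C) (f : iso A B) : iso A C :=
  MkIso (iso_comp_subproof g f).1 (iso_comp_subproof g f).2.

Definition eqtoiso (A B : K) (e : A = B) : iso A B :=
  let: erefl := e in iso_id A.

Lemma iso_isiso (A B : K) (f : iso A B) : is_iso f.
Proof. by exists (f^-1); split; [apply: isoK|apply: isoVK]. Qed.

Lemma iso_of_isiso (A B : K) (f : Hom A B) :
  is_iso f -> exists g : iso A B, isom g = f.
Proof. by move=> [g [gf fg]]; exists (MkIso gf fg). Qed.

Lemma compK (A B C : K) (f : iso A B) (g : Hom C A) : f^-1 \o (f \o g) = g.
Proof. by rewrite compA isoK comp1m. Qed.

Lemma compVK (A B C : K) (f : iso A B) (g : Hom C B) : f \o (f^-1 \o g) = g.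
Proof. by rewrite compA isoVK comp1m. Qed.

Lemma comp_can (A B C : K) (f : iso A B) (g : Hom B C) : (g \o f) \o f^-1 = g.
Proof. by rewrite -compA isoVK compm1. Qed.

Lemma comp_canV (A B C : K) (f : iso A B) (g : Hom A C) : (g \o f^-1) \o f = g.
Proof. by rewrite -compA isoK compm1. Qed.

Lemma iso_mono (A B C : K) (f : iso A B) (g h : Hom C A) :
  f \o g = f \o h -> g = h.
Proof. by move=> e; rewrite -(compK f g) e compK. Qed.

Lemma iso_epi (A B C : K) (f : iso A B) (g h : Hom B C) :
  g \o f = h \o f -> g = h.
Proof. by move=> e; rewrite -(comp_can f g) e comp_can. Qed.

Lemma iso_sqV (A B A' B' : K) (a : iso A A') (b : iso B B')
    (f : Hom A B) (f' : Hom A' B') :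
  b \o f = f' \o a -> b^-1 \o f' = f \o a^-1.
Proof.
by move=> e; apply: (@iso_mono _ _ _ b); rewrite compVK compA e comp_can.
Qed.

Lemma compE (A B B' C D : K) (g : Hom B C) (f : Hom A B)
    (g' : Hom B' C) (f' : Hom A B') (x : Hom D A) :
  g \o f = g' \o f' -> g \o (f \o x) = g' \o (f' \o x).
Proof. by move=> e; rewrite !compA e. Qed.

Lemma is_iso_comp (A B C : K) (g : Hom B C) (f : Hom A B) :
  is_iso g -> is_iso f -> is_iso (g \o f).
Proof.
move=> /iso_of_isiso[g' <-] /iso_of_isiso[f' <-].
exact: iso_isiso (iso_comp g' f').
Qed.

End Isos.

Definition slice_hom (K : Category) (X : K) (f g : {A : K & Hom A X}) : Type :=
  {h : Hom (projT1 f) (projT1 g) | projT2 g \o h = projT2 f}.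

Lemma slice_hom_inj (K : Category) (X : K) (f g : {A : K & Hom A X})
  (h k : slice_hom f g) : sval h = sval k -> h = k.
Proof.
by case: h k => [h ?] [k ?] /= hk; move: hk => ?; subst; congr exist.
Qed.

Definition slice_id (K : Category) (X : K) (f : {A : K & Hom A X}) :
  slice_hom f f := exist _ (idm _) (compm1 _).

Lemma slice_comp_subproof (K : Category) (X : K) (f g h : {A : K & Hom A X})
  (b : slice_hom g h) (a : slice_hom f g) :
  projT2 h \o (sval b \o sval a) = projT2 f.
Proof. by rewrite compA (svalP b) (svalP a). Qed.

Definition slice_comp (K : Category) (X : K) (f g h : {A : K & Hom A X})
  (b : slice_hom g h) (a : slice_hom f g) : slice_hom f h :=
  exist _ (sval b \o sval a) (slice_comp_subproof b a).

Program Definition slice (K : Category) (X : K) : Category :=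
  @MkCategory {A : K & Hom A X} (@slice_hom K X)
    (@slice_id K X) (@slice_comp K X) _ _ _.
Next Obligation. by move=> *; apply: slice_hom_inj; apply: compA. Qed.
Next Obligation. by move=> *; apply: slice_hom_inj; apply: comp1m. Qed.
Next Obligation. by move=> *; apply: slice_hom_inj; apply: compm1. Qed.

Record MonoidalCategory := MkMonoidal {
  mcat :> Category;
  tenO : mcat -> mcat -> mcat;
  unitO : mcat;
  tenH : forall A A' B B' : mcat,
    Hom A A' -> Hom B B' -> Hom (tenO A B) (tenO A' B');
  tenH_id : forall A B, tenH (idm A) (idm B) = idm (tenO A B);
  tenH_comp : forall A A' A'' B B' B'' (f' : Hom A' A'') (f : Hom A A')
    (g' : Hom B' B'') (g : Hom B B'),
    tenH (f' \o f) (g' \o g) = tenH f' g' \o tenH f g;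
  alpha : forall A B C, iso (tenO (tenO A B) C) (tenO A (tenO B C));
  lam : forall A, iso (tenO unitO A) A;
  rho : forall A, iso (tenO A unitO) A;
  alpha_nat : forall A A' B B' C C'
    (f : Hom A A') (g : Hom B B') (h : Hom C C'),
    alpha A' B' C' \o tenH (tenH f g) h = tenH f (tenH g h) \o alpha A B C;
  lam_nat : forall A A' (f : Hom A A'),
    lam A' \o tenH (idm unitO) f = f \o lam A;
  rho_nat : forall A A' (f : Hom A A'),
    rho A' \o tenH f (idm unitO) = f \o rho A;
  pentagon : forall A B C D,
    alpha A B (tenO C D) \o alpha (tenO A B) C D =
    tenH (idm A) (alpha B C D) \o alpha A (tenO B C) D
      \o tenH (alpha A B C) (idm D);
  triangle : forall A B,
    tenH (idm A) (lam B) \o alpha A unitO B = tenH (rho A) (idm B)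
}.

Arguments tenO {m} A B : rename.
Arguments unitO {m} : rename.
Arguments tenH {m A A' B B'} f g : rename.
Arguments alpha {m} A B C : rename.
Arguments lam {m} A : rename.
Arguments rho {m} A : rename.

Notation "A \ox B" := (tenO A B) : cat_scope.
Notation "f \ot g" := (tenH f g) : cat_scope.

Record BraidedMonoidalCategory := MkBraided {
  bmon :> MonoidalCategory;
  braid : forall A B : bmon, iso (A \ox B) (B \ox A);
  braid_nat : forall (A A' B B' : bmon) (f : Hom A A') (g : Hom B B'),
    braid A' B' \o (f \ot g) = (g \ot f) \o braid A B;
  hexagon1 : forall A B C : bmon,
    alpha B C A \o braid A (B \ox C) \o alpha A B C =
    (idm B \ot braid A C) \o alpha B A C \o (braid A B \ot idm C);
  hexagon2 : forall A B C : bmon,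
    (alpha C A B)^-1 \o braid (A \ox B) C \o (alpha A B C)^-1 =
    (braid A C \ot idm B) \o (alpha A C B)^-1 \o (idm A \ot braid B C)
}.

Arguments braid {b} A B : rename.

Section MonoidalIsos.
Variable M : MonoidalCategory.

Lemma tenH_comp1 (A A' A'' B : M) (f' : Hom A' A'') (f : Hom A A') :
  (f' \o f) \ot idm B = (f' \ot idm B) \o (f \ot idm B).
Proof. by rewrite -tenH_comp comp1m. Qed.

Lemma tenH_1comp (A A' A'' B : M) (f' : Hom A' A'') (f : Hom A A') :
  idm B \ot (f' \o f) = (idm B \ot f') \o (idm B \ot f).
Proof. by rewrite -tenH_comp comp1m. Qed.

Lemma tenH_comp1E (A A' A'' B X : M) (f' : Hom A' A'') (f : Hom A A')
  (x : Hom X (A \ox B)) :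
  (f' \ot idm B) \o ((f \ot idm B) \o x) = ((f' \o f) \ot idm B) \o x.
Proof. by rewrite tenH_comp1 compA. Qed.

Lemma tenH_1compE (A A' A'' B X : M) (f' : Hom A' A'') (f : Hom A A')
  (x : Hom X (B \ox A)) :
  (idm B \ot f') \o ((idm B \ot f) \o x) = (idm B \ot (f' \o f)) \o x.
Proof. by rewrite tenH_1comp compA. Qed.

Lemma tenH_split (A A' B B' : M) (f : Hom A A') (g : Hom B B') :
  f \ot g = (f \ot idm B') \o (idm A \ot g).
Proof. by rewrite -tenH_comp comp1m compm1. Qed.

Lemma tenH_split' (A A' B B' : M) (f : Hom A A') (g : Hom B B') :
  f \ot g = (idm A' \ot g) \o (f \ot idm B).
Proof. by rewrite -tenH_comp comp1m compm1. Qed.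

Lemma iso_ten_subproof (A A' B B' : M) (f : iso A A') (g : iso B B') :
  (f^-1 \ot g^-1) \o (f \ot g) = idm (A \ox B) /\
  (f \ot g) \o (f^-1 \ot g^-1) = idm (A' \ox B').
Proof. by rewrite -!tenH_comp !isoK !isoVK !tenH_id. Qed.

Definition iso_ten (A A' B B' : M) (f : iso A A') (g : iso B B') :
  iso (A \ox B) (A' \ox B') :=
  MkIso (iso_ten_subproof f g).1 (iso_ten_subproof f g).2.

Lemma is_iso_ten (A A' B B' : M) (f : Hom A A') (g : Hom B B') :
  is_iso f -> is_iso g -> is_iso (f \ot g).
Proof.
move=> /iso_of_isiso[f' <-] /iso_of_isiso[g' <-].
exact: iso_isiso (iso_ten f' g').
Qed.

Lemma ten1_inj (A B : M) (f g : Hom A B) :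
  idm (@unitO M) \ot f = idm unitO \ot g -> f = g.
Proof.
by move=> e; apply: (iso_epi (f := lam A)); rewrite -!lam_nat e.
Qed.

Lemma lam_ten (A B : M) : lam (A \ox B) \o alpha unitO A B = lam A \ot idm B.
Proof.
apply: ten1_inj; rewrite tenH_1comp.
apply: (iso_epi (f := iso_comp (alpha unitO (unitO \ox A) B)
                        (iso_ten (alpha unitO unitO A) (iso_id B)))) => /=.
transitivity (idm unitO \ot lam (A \ox B)
   \o (alpha unitO unitO (A \ox B) \o alpha (unitO \ox unitO) A B)).
  by rewrite pentagon -!compA.
rewrite compA triangle compA -alpha_nat -compA -tenH_comp1 triangle.
by rewrite -tenH_id alpha_nat.
Qed.

End MonoidalIsos.

(* A [reading] of an object [A] is a description of the endofunctor [A \ox -]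
   up to isomorphism, in which the tensor product becomes the composition of
   functions.  Through readings, structural isomorphisms become identities,
   which is how all the coherence conditions below are proved. *)

Section Coherence.
Variable M : MonoidalCategory.
Implicit Types A B C X Y : M.

Record reading A := MkReading {
  act : M -> M;
  nf : forall X, iso (A \ox X) (act X)
}.

Definition rgen A : reading A := MkReading (fun X => iso_id (A \ox X)).
Definition rone : reading unitO := MkReading (fun X => lam X).
Definition rten A B (r : reading A) (s : reading B) : reading (A \ox B) :=
  MkReading (fun X => iso_comp (nf r (act s X))
     (iso_comp (iso_ten (iso_id A) (nf s X)) (alpha A B X))).

(* Locked, so that rewriting does not see through it. *)
Fact tr_key : unit. Proof. by []. Qed.

Definition tr A B (r : reading A) (s : reading B) (f : Hom A B) X :
  Hom (act r X) (act s X) :=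
  locked_with tr_key (nf s X \o ((f \ot idm X) \o (nf r X)^-1)).

Lemma trE A B (r : reading A) (s : reading B) (f : Hom A B) X :
  tr r s f X = nf s X \o ((f \ot idm X) \o (nf r X)^-1).
Proof. by rewrite /tr unlock. Qed.

Definition lift A (r : reading A) X Y (h : Hom X Y) : Hom (act r X) (act r Y) :=
  locked_with tr_key (nf r Y \o ((idm A \ot h) \o (nf r X)^-1)).

Lemma liftE A (r : reading A) X Y (h : Hom X Y) :
  lift r h = nf r Y \o ((idm A \ot h) \o (nf r X)^-1).
Proof. by rewrite /lift unlock. Qed.

Lemma tr_inj A B (r : reading A) (s : reading B) (f g : Hom A B) :
  (forall X, tr r s f X = tr r s g X) -> f = g.
Proof.
move=> /(_ unitO); rewrite !trE => /iso_mono /(iso_epi (f := iso_sym (nf r _))) e.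
by apply: (iso_epi (f := rho A)); rewrite -!rho_nat e.
Qed.

Lemma tr_comp A B C (r : reading A) (s : reading B) (t : reading C)
  (g : Hom B C) (f : Hom A B) X :
  tr r t (g \o f) X = tr s t g X \o tr r s f X.
Proof. by rewrite ?trE tenH_comp1 -!compA compK. Qed.

Lemma tr_id A (r : reading A) X : tr r r (idm A) X = idm (act r X).
Proof. by rewrite ?trE tenH_id comp1m isoVK. Qed.

Lemma tr_ten A A' B B' (r : reading A) (r' : reading A') (s : reading B)
  (s' : reading B') (f : Hom A A') (g : Hom B B') X :
  tr (rten r s) (rten r' s') (f \ot g) X =
  tr r r' f (act s' X) \o lift r (tr s s' g X).
Proof.
rewrite ?trE ?liftE /= -!compA; congr (_ \o _).
rewrite compK !tenH_1comp -!compA.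
rewrite (compE _ (alpha_nat _ _ _)) compVK.
rewrite compA -tenH_comp comp1m compA -tenH_comp compm1.
by rewrite !compA -!tenH_comp !compm1 comp1m.
Qed.

Lemma tr_nat A B (r : reading A) (s : reading B) (f : Hom A B) X Y
  (h : Hom X Y) : tr r s f Y \o lift r h = lift s h \o tr r s f X.
Proof.
rewrite ?trE ?liftE -!compA !compK; congr (_ \o _); rewrite !compA.
by rewrite -!tenH_comp !comp1m !compm1.
Qed.

Lemma lift_comp A (r : reading A) X Y Z (k : Hom Y Z) (h : Hom X Y) :
  lift r (k \o h) = lift r k \o lift r h.
Proof. by rewrite ?liftE tenH_1comp -!compA compK. Qed.

Lemma lift_id A (r : reading A) X : lift r (idm X) = idm (act r X).
Proof. by rewrite ?liftE tenH_id comp1m isoVK. Qed.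

Lemma lift_gen A X Y (h : Hom X Y) : lift (rgen A) h = idm A \ot h.
Proof. by rewrite ?liftE /= comp1m compm1. Qed.

Lemma lift_one X Y (h : Hom X Y) : lift rone h = h.
Proof. by rewrite ?liftE /= compA lam_nat comp_can. Qed.

Lemma lift_ten A B (r : reading A) (s : reading B) X Y (h : Hom X Y) :
  lift (rten r s) h = lift r (lift s h).
Proof.
rewrite ?liftE /= -!compA; congr (_ \o _).
rewrite !tenH_1comp -!compA; congr (_ \o _).
rewrite -tenH_id (compE _ (alpha_nat _ _ _)) !compA.
by rewrite -(compA _ (alpha _ _ _)) isoVK compm1.
Qed.

Lemma tr_alpha A B C (r : reading A) (s : reading B) (t : reading C) X :
  tr (rten (rten r s) t) (rten r (rten s t)) (alpha A B C) X =
  idm (act r (act s (act t X))).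
Proof.
rewrite ?trE -(isoVK (nf (rten (rten r s) t) X)) compA; congr (_ \o _).
rewrite /= -!compA; congr (_ \o _).
rewrite !tenH_1comp -!compA; congr (_ \o _).
rewrite -tenH_id (compE _ (alpha_nat _ _ _)).
by rewrite !compA -(compA _ (alpha _ _ _) (alpha _ _ _)) pentagon !compA.
Qed.

Lemma tr_lam A (r : reading A) X :
  tr (rten rone r) r (lam A) X = idm (act r X).
Proof.
rewrite ?trE -(isoVK (nf (rten rone r) X)) compA; congr (_ \o _).
by rewrite /= compA lam_nat -compA lam_ten.
Qed.

Lemma tr_rho A (r : reading A) X :
  tr (rten r rone) r (rho A) X = idm (act r X).
Proof.
rewrite ?trE -(isoVK (nf (rten r rone) X)) compA; congr (_ \o _).
by rewrite /= triangle.
Qed.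

Lemma tr_inv A B (r : reading A) (s : reading B) (f : iso A B) X :
  tr r s f X \o tr s r (f^-1) X = idm _ /\
  tr s r (f^-1) X \o tr r s f X = idm _.
Proof. by rewrite -!tr_comp isoK isoVK !tr_id. Qed.

Lemma tr_alphaV A B C (r : reading A) (s : reading B) (t : reading C) X :
  tr (rten r (rten s t)) (rten (rten r s) t) ((alpha A B C)^-1) X =
  idm (act r (act s (act t X))).
Proof.
have [+ _] := tr_inv (rten (rten r s) t) (rten r (rten s t)) (alpha A B C) X.
by rewrite tr_alpha comp1m.
Qed.

Lemma tr_lamV A (r : reading A) X :
  tr r (rten rone r) ((lam A)^-1) X = idm (act r X).
Proof.
have [+ _] := tr_inv (rten rone r) r (lam A) X.
by rewrite tr_lam comp1m.
Qed.

Lemma tr_rhoV A (r : reading A) X :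
  tr r (rten r rone) ((rho A)^-1) X = idm (act r X).
Proof.
have [+ _] := tr_inv (rten r rone) r (rho A) X.
by rewrite tr_rho comp1m.
Qed.

Definition canon A B (r : reading A) (s : reading B) (f : Hom A B) : Prop :=
  forall X, exists e : act r X = act s X, tr r s f X = eqtoiso e.

Lemma canon_inj A B (r : reading A) (s : reading B) (f g : Hom A B) :
  canon r s f -> canon r s g -> f = g.
Proof.
move=> cf cg; apply: (@tr_inj _ _ r s) => X.
by have [e ->] := cf X; have [e' ->] := cg X; rewrite (Prop_irrelevance e e').
Qed.

Lemma canon_id A (r : reading A) : canon r r (idm A).
Proof. by move=> X; exists erefl; rewrite tr_id. Qed.

Lemma eqtoiso_comp A B C (e : A = B) (e' : B = C) :
  eqtoiso e' \o eqtoiso e = eqtoiso (etrans e e').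
Proof. by case: _ / e'; rewrite comp1m. Qed.

Lemma lift_eqtoiso A (r : reading A) X Y (e : X = Y) :
  lift r (eqtoiso e) = eqtoiso (congr1 (act r) e).
Proof. by case: _ / e; rewrite lift_id. Qed.

Lemma canon_comp A B C (r : reading A) (s : reading B) (t : reading C)
  (g : Hom B C) (f : Hom A B) :
  canon r s f -> canon s t g -> canon r t (g \o f).
Proof.
move=> cf cg X; rewrite (tr_comp r s t).
have [e ->] := cf X; have [e' ->] := cg X.
by exists (etrans e e'); rewrite eqtoiso_comp.
Qed.

Lemma canon_ten A A' B B' (r : reading A) (r' : reading A') (s : reading B)
  (s' : reading B') (f : Hom A A') (g : Hom B B') :
  canon r r' f -> canon s s' g -> canon (rten r s) (rten r' s') (f \ot g).
Proof.
move=> cf cg X; rewrite tr_ten; have [e ->] := cf (act s' X).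
have [e' ->] := cg X; exists (etrans (congr1 (act r) e') e).
by rewrite lift_eqtoiso eqtoiso_comp.
Qed.

Lemma canon_alpha A B C (r : reading A) (s : reading B) (t : reading C) :
  canon (rten (rten r s) t) (rten r (rten s t)) (alpha A B C).
Proof. by move=> X; exists erefl; rewrite tr_alpha. Qed.

Lemma canon_lam A (r : reading A) : canon (rten rone r) r (lam A).
Proof. by move=> X; exists erefl; rewrite tr_lam. Qed.

Lemma canon_rho A (r : reading A) : canon (rten r rone) r (rho A).
Proof. by move=> X; exists erefl; rewrite tr_rho. Qed.

Lemma eqtoisoV A B (e : A = B) : (eqtoiso e)^-1 = eqtoiso (esym e).
Proof. by case: _ / e. Qed.

Lemma canon_inv A B (r : reading A) (s : reading B) (f : iso A B) :
  canon r s f -> canon s r (f^-1).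
Proof.
move=> cf X; have [e fe] := cf X; have [_] := tr_inv r s f X.
rewrite fe => he; exists (esym e).
by rewrite -[LHS](comp_can (eqtoiso e)) he comp1m eqtoisoV.
Qed.

End Coherence.

Arguments rone {M}.

Section LeftBracketing.
Variable M : MonoidalCategory.
Implicit Types (A B C : M) (S T : seq M).

(* [lbprod [:: A; B; C; ...]] is [((A \ox B) \ox C) \ox ...]. *)
Definition lbprod S : M :=
  if S is A :: S' then foldl tenO A S' else unitO.

Fixpoint foldl_iso A B (f : iso A B) S :
    iso (foldl tenO A S) (foldl tenO B S) :=
  if S is C :: S' then foldl_iso (iso_ten f (iso_id C)) S' else f.

Fixpoint shift_iso A B S :
    iso (A \ox foldl tenO B S) (foldl tenO (A \ox B) S) :=
  if S is C :: S' then
    iso_comp (foldl_iso (iso_sym (alpha A B C)) S') (shift_iso A (B \ox C) S')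
  else iso_id (A \ox B).

Definition absorb_iso A S : iso (A \ox lbprod S) (foldl tenO A S) :=
  if S is B :: S' then shift_iso A B S' else rho A.

Fixpoint foldl_cat_iso A S T :
    iso (foldl tenO A S \ox lbprod T) (foldl tenO A (S ++ T)) :=
  if S is B :: S' then foldl_cat_iso (A \ox B) S' T else absorb_iso A T.

(* A composite of structural isomorphisms, and hence, by [canon_lbprod_cat] and
   [canon_inj], the only one between these two bracketings. *)
Definition lbprod_cat S T : iso (lbprod S \ox lbprod T) (lbprod (S ++ T)) :=
  if S is A :: S' then foldl_cat_iso A S' T else lam (lbprod T).

Fixpoint rfoldl A (r : reading A) S : reading (foldl tenO A S) :=
  if S is B :: S' then rfoldl (rten r (rgen B)) S' else r.

Definition rlb S : reading (lbprod S) :=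
  if S is A :: S' then rfoldl (rgen A) S' else rone.

Lemma canon_lbprod_cat S T :
  canon (rten (rlb S) (rlb T)) (rlb (S ++ T)) (lbprod_cat S T).
Proof.
have cmap : forall U A B (r : reading A) (s : reading B) (f : iso A B),
    canon r s f -> canon (rfoldl r U) (rfoldl s U) (foldl_iso f U).
  elim=> [//|C U IH] A B r s f cf; apply: IH.
  by apply: canon_ten => //; apply: canon_id.
have cshift : forall U A B (r : reading A) (s : reading B),
    canon (rten r (rfoldl s U)) (rfoldl (rten r s) U) (shift_iso A B U).
  elim=> [|C U IH] A B r s; first exact: canon_id.
  apply: canon_comp (IH _ _ _ _) _; apply: cmap.
  by apply: canon_inv; apply: canon_alpha.
have cabs U A (r : reading A) :
    canon (rten r (rlb U)) (rfoldl r U) (absorb_iso A U).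
  by case: U => [|B U]; [apply: canon_rho|apply: cshift].
have ccat : forall U A (r : reading A),
    canon (rten (rfoldl r U) (rlb T)) (rfoldl r (U ++ T)) (foldl_cat_iso A U T).
  by elim=> [|C U IH] A r; [apply: cabs|apply: IH].
by case: S => [|A S]; [apply: canon_lam|apply: ccat].
Qed.

Lemma canon_eqtoiso S T (e : lbprod S = lbprod T) (e' : S = T) :
  canon (rlb S) (rlb T) (eqtoiso e).
Proof.
by move: e; case: _ / e' => e; rewrite (Prop_irrelevance e erefl); apply: canon_id.
Qed.

End LeftBracketing.

Ltac reading_of A :=
  lazymatch A with
  | tenO ?B ?C =>
      let r := reading_of B in let s := reading_of C in constr:(rten r s)
  | @unitO ?M => constr:(@rone M)
  | lbprod ?S => constr:(rlb S)
  | _ => constr:(rgen A)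
  end.

Ltac canonical :=
  lazymatch goal with
  | |- canon _ _ (idm _) => apply: canon_id
  | |- canon _ _ (compm _ _) => eapply canon_comp; [canonical | canonical]
  | |- canon _ _ (tenH _ _) => eapply canon_ten; [canonical | canonical]
  | |- canon _ _ (isom (alpha _ _ _)) => apply: canon_alpha
  | |- canon _ _ (isom (lam _)) => apply: canon_lam
  | |- canon _ _ (isom (rho _)) => apply: canon_rho
  | |- canon _ _ (isom (lbprod_cat _ _)) => apply: canon_lbprod_cat
  | |- canon _ _ (isom (eqtoiso _)) => apply: canon_eqtoiso
  | |- canon _ _ (isoinv _) => apply: canon_inv; canonical
  end.

(* Proves equalities between composites of structural isomorphisms. *)
Ltac coherence :=
  lazymatch goal with
  | |- @eq (@Hom _ ?A ?B) _ _ =>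
      let r := reading_of A in let s := reading_of B in
      apply: (@canon_inj _ _ _ r s); canonical
  end.

Section Strictification.
Variable C : BraidedMonoidalCategory.
Implicit Types R S T U : seq C.

Definition strict_category : Category :=
  @MkCategory (seq C) (fun S T => Hom (lbprod S) (lbprod T))
    (fun S => idm (lbprod S)) (fun R S T g f => g \o f)
    (fun R S T U h g f => compA h g f)
    (fun S T f => comp1m f) (fun S T f => compm1 f).

Definition strict_tenH R S T U (f : Hom (lbprod R) (lbprod S))
    (g : Hom (lbprod T) (lbprod U)) : Hom (lbprod (R ++ T)) (lbprod (S ++ U)) :=
  lbprod_cat S U \o (f \ot g) \o (lbprod_cat R T)^-1.

(* Concatenation of sequences is associative and right unital only up to a
   propositional equality: the identity constraints of the strict monoidal
   structure are therefore transports of identity morphisms. *)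
Definition strict_alpha R S T :
    iso (((R ++ S) ++ T) : strict_category) (R ++ (S ++ T)) :=
  @eqtoiso strict_category _ _ (esym (catA R S T)).

Definition strict_lam S : iso (([::] ++ S) : strict_category) S :=
  @eqtoiso strict_category _ _ (cat0s S).

Definition strict_rho S : iso ((S ++ [::]) : strict_category) S :=
  @eqtoiso strict_category _ _ (cats0 S).

Lemma strict_eqtoiso S T (e : S = T) :
  isom (@eqtoiso strict_category S T e) = eqtoiso (congr1 (@lbprod C) e).
Proof. by case: _ / e. Qed.

Lemma strict_eqtoisoV S T (e : S = T) :
  isoinv (@eqtoiso strict_category S T e) =
  eqtoiso (congr1 (@lbprod C) (esym e)).
Proof. by case: _ / e. Qed.

Lemma strict_tenH_cat R S T U (f : Hom (lbprod R) (lbprod S))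
    (g : Hom (lbprod T) (lbprod U)) :
  strict_tenH f g \o lbprod_cat R T = lbprod_cat S U \o (f \ot g).
Proof. by rewrite /strict_tenH comp_canV. Qed.

Lemma strict_alpha_cat R S T :
  (isom (strict_alpha R S T) : Hom (lbprod _) (lbprod _)) \o
    (lbprod_cat (R ++ S) T \o (lbprod_cat R S \ot idm (lbprod T))) =
  lbprod_cat R (S ++ T) \o
    ((idm (lbprod R) \ot lbprod_cat S T) \o alpha _ _ _).
Proof. by rewrite strict_eqtoiso; coherence; apply/esym/catA. Qed.

Lemma strict_tenH_id S T :
  strict_tenH (idm (lbprod S)) (idm (lbprod T)) = idm (lbprod (S ++ T)).
Proof. by rewrite /strict_tenH tenH_id compm1 isoVK. Qed.

Lemma strict_tenH_comp R R' R'' S S' S''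
    (f' : Hom (lbprod R') (lbprod R'')) (f : Hom (lbprod R) (lbprod R'))
    (g' : Hom (lbprod S') (lbprod S'')) (g : Hom (lbprod S) (lbprod S')) :
  strict_tenH (f' \o f) (g' \o g) = strict_tenH f' g' \o strict_tenH f g.
Proof. by rewrite /strict_tenH tenH_comp -!compA compK. Qed.

Lemma strict_alpha_nat R R' S S' T T'
    (f : Hom (lbprod R) (lbprod R')) (g : Hom (lbprod S) (lbprod S'))
    (h : Hom (lbprod T) (lbprod T')) :
  (isom (strict_alpha R' S' T') : Hom (lbprod _) (lbprod _)) \o
    strict_tenH (strict_tenH f g) h =
  strict_tenH f (strict_tenH g h) \o
    (isom (strict_alpha R S T) : Hom (lbprod _) (lbprod _)).
Proof.
apply: (iso_epi (f := iso_comp (lbprod_cat (R ++ S) T)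
  (iso_ten (lbprod_cat R S) (iso_id (lbprod T))))) => /=.
rewrite -!compA strict_alpha_cat !compK -tenH_comp strict_tenH_cat compm1.
rewrite (compA _ (idm _ \ot _)) -tenH_comp strict_tenH_cat compm1.
have -> : (lbprod_cat R' S' \o f \ot g) \ot h =
    (lbprod_cat R' S' \ot idm _) \o ((f \ot g) \ot h).
  by rewrite -tenH_comp comp1m.
have -> : f \ot (lbprod_cat S' T' \o g \ot h) =
    (idm _ \ot lbprod_cat S' T') \o (f \ot (g \ot h)).
  by rewrite -tenH_comp comp1m.
by rewrite -!compA -alpha_nat !compA -(compA _ (lbprod_cat _ _)) strict_alpha_cat
   !compA.
Qed.

Lemma strict_lam_nat S T (f : Hom (lbprod S) (lbprod T)) :
  (isom (strict_lam T) : Hom (lbprod _) (lbprod _)) \o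
    strict_tenH (idm (lbprod [::])) f =
  f \o (isom (strict_lam S) : Hom (lbprod _) (lbprod _)).
Proof.
have lamE U : isom (strict_lam U) = idm (lbprod U).
  by rewrite strict_eqtoiso (Prop_irrelevance (congr1 _ _) erefl).
by rewrite !lamE comp1m compm1 /strict_tenH /= lam_nat comp_can.
Qed.

Lemma strict_rho_cat S :
  (isom (strict_rho S) : Hom (lbprod _) (lbprod _)) \o lbprod_cat S [::] =
  rho (lbprod S).
Proof.
rewrite strict_eqtoiso.
apply: (@canon_inj _ _ _ (rten (rlb S) (rlb [::])) (rlb S)).
  by canonical; apply: cats0.
exact: canon_rho.
Qed.

Lemma strict_rho_nat S T (f : Hom (lbprod S) (lbprod T)) :
  (isom (strict_rho T) : Hom (lbprod _) (lbprod _)) \o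
    strict_tenH f (idm (lbprod [::])) =
  f \o (isom (strict_rho S) : Hom (lbprod _) (lbprod _)).
Proof.
apply: (iso_epi (f := lbprod_cat S [::])).
by rewrite -!compA strict_rho_cat isoK compm1 compA strict_rho_cat rho_nat.
Qed.

Lemma strict_pentagon R S T U :
  (isom (strict_alpha R S (T ++ U)) : Hom (lbprod _) (lbprod _)) \o
    (isom (strict_alpha (R ++ S) T U) : Hom (lbprod _) (lbprod _)) =
  strict_tenH (idm (lbprod R))
      (isom (strict_alpha S T U) : Hom (lbprod _) (lbprod _)) \o
    (isom (strict_alpha R (S ++ T) U) : Hom (lbprod _) (lbprod _)) \o
    strict_tenH (isom (strict_alpha R S T) : Hom (lbprod _) (lbprod _))
      (idm (lbprod U)).
Proof.
by rewrite /strict_tenH !strict_eqtoiso; coherence; rewrite ?catA.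
Qed.

Lemma strict_triangle S T :
  strict_tenH (idm (lbprod S))
      (isom (strict_lam T) : Hom (lbprod _) (lbprod _)) \o
    (isom (strict_alpha S [::] T) : Hom (lbprod _) (lbprod _)) =
  strict_tenH (isom (strict_rho S) : Hom (lbprod _) (lbprod _))
    (idm (lbprod T)).
Proof.
rewrite /strict_tenH !strict_eqtoiso.
by coherence; rewrite ?cats0 -?catA.
Qed.

Definition strict_braid S T : iso ((S ++ T) : strict_category) (T ++ S) :=
  let f := iso_comp (lbprod_cat T S)
             (iso_comp (braid (lbprod S) (lbprod T))
                       (iso_sym (lbprod_cat S T))) in
  @MkIso strict_category (S ++ T) (T ++ S) f (f^-1) (isoK f) (isoVK f).

Definition strict_monoidal : MonoidalCategory :=
  @MkMonoidal strict_category (@cat C) [::] strict_tenH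
    strict_tenH_id strict_tenH_comp strict_alpha strict_lam strict_rho
    strict_alpha_nat strict_lam_nat strict_rho_nat
    strict_pentagon strict_triangle.

Lemma strict_alpha_catE R S T A (x : Hom A _) :
  (isom (strict_alpha R S T) : Hom (lbprod _) (lbprod _)) \o
    (lbprod_cat (R ++ S) T \o ((lbprod_cat R S \ot idm (lbprod T)) \o x)) =
  lbprod_cat R (S ++ T) \o
    ((idm (lbprod R) \ot lbprod_cat S T) \o (alpha _ _ _ \o x)).
Proof. by have /(congr1 (fun y => y \o x)) := strict_alpha_cat R S T; rewrite -!compA. Qed.

Lemma strict_alphaV_cat R S T :
  ((strict_alpha R S T)^-1 : Hom (lbprod _) (lbprod _)) \o
    (lbprod_cat R (S ++ T) \o (idm (lbprod R) \ot lbprod_cat S T)) =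
  lbprod_cat (R ++ S) T \o
    ((lbprod_cat R S \ot idm (lbprod T)) \o (alpha _ _ _)^-1).
Proof. by rewrite strict_eqtoisoV; coherence; apply: catA. Qed.

Lemma strict_alphaV_catE R S T A (x : Hom A _) :
  ((strict_alpha R S T)^-1 : Hom (lbprod _) (lbprod _)) \o
    (lbprod_cat R (S ++ T) \o ((idm (lbprod R) \ot lbprod_cat S T) \o x)) =
  lbprod_cat (R ++ S) T \o
    ((lbprod_cat R S \ot idm (lbprod T)) \o ((alpha _ _ _)^-1 \o x)).
Proof. by have /(congr1 (fun y => y \o x)) := strict_alphaV_cat R S T; rewrite -!compA. Qed.

Lemma strict_braid_nat R R' S S' (f : Hom (lbprod R) (lbprod R'))
    (g : Hom (lbprod S) (lbprod S')) :
  (isom (strict_braid R' S') : Hom (lbprod _) (lbprod _)) \o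
    strict_tenH f g =
  strict_tenH g f \o (isom (strict_braid R S) : Hom (lbprod _) (lbprod _)).
Proof.
by rewrite /strict_tenH /= -!compA !compK (compE _ (braid_nat _ _)).
Qed.

Lemma strict_hexagon1 R S T :
  (isom (strict_alpha S T R) : Hom (lbprod _) (lbprod _)) \o
    (isom (strict_braid R (S ++ T)) : Hom (lbprod _) (lbprod _)) \o
    (isom (strict_alpha R S T) : Hom (lbprod _) (lbprod _)) =
  strict_tenH (idm (lbprod S))
      (isom (strict_braid R T) : Hom (lbprod _) (lbprod _)) \o
    (isom (strict_alpha S R T) : Hom (lbprod _) (lbprod _)) \o
    strict_tenH (isom (strict_braid R S) : Hom (lbprod _) (lbprod _))
      (idm (lbprod T)).
Proof.
apply: (iso_epi (f := iso_comp (lbprod_cat (R ++ S) T)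
  (iso_ten (lbprod_cat R S) (iso_id (lbprod T))))).
rewrite /strict_tenH /= -!compA strict_alpha_cat !compK.
rewrite (compE _ (braid_nat _ _)) strict_alpha_catE.
rewrite -!tenH_comp1 -!compA isoK compm1 !tenH_comp1 strict_alpha_catE compK.
rewrite tenH_1compE -!compA isoK compm1.
rewrite tenH_1comp -!compA.
by have := hexagon1 (lbprod R) (lbprod S) (lbprod T); rewrite -!compA => ->.
Qed.

Lemma strict_hexagon2 R S T :
  ((strict_alpha T R S)^-1 : Hom (lbprod _) (lbprod _)) \o
    (isom (strict_braid (R ++ S) T) : Hom (lbprod _) (lbprod _)) \o
    ((strict_alpha R S T)^-1 : Hom (lbprod _) (lbprod _)) =
  strict_tenH (isom (strict_braid R T) : Hom (lbprod _) (lbprod _))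
      (idm (lbprod S)) \o
    ((strict_alpha R T S)^-1 : Hom (lbprod _) (lbprod _)) \o
    strict_tenH (idm (lbprod R))
      (isom (strict_braid S T) : Hom (lbprod _) (lbprod _)).
Proof.
apply: (iso_epi (f := iso_comp (lbprod_cat R (S ++ T))
  (iso_ten (iso_id (lbprod R)) (lbprod_cat S T)))).
rewrite /strict_tenH /= -!compA strict_alphaV_cat !compK.
rewrite (compE _ (braid_nat _ _)) strict_alphaV_catE.
rewrite -!tenH_1comp -!compA isoK compm1 !tenH_1comp strict_alphaV_catE compK.
rewrite tenH_comp1E -!compA isoK compm1.
rewrite tenH_comp1 -!compA.
by have := hexagon2 (lbprod R) (lbprod S) (lbprod T); rewrite -!compA => ->.
Qed.

Definition strictification : BraidedMonoidalCategory :=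
  @MkBraided strict_monoidal strict_braid
    strict_braid_nat strict_hexagon1 strict_hexagon2.

End Strictification.

Record half_braiding (M : MonoidalCategory) (U : M) := MkHalfBraiding {
  hb :> forall A : M, iso (U \ox A) (A \ox U);
  hb_nat : forall (A B : M) (f : Hom A B),
    hb B \o (idm U \ot f) = (f \ot idm U) \o hb A;
  hb_ten : forall A B : M,
    hb (A \ox B) = (alpha A B U)^-1 \o (idm A \ot hb B) \o alpha A U B
                     \o (hb A \ot idm B) \o (alpha U A B)^-1 :> Hom _ _
}.

Record center_ob (M : MonoidalCategory) := MkCenterOb {
  cob :> M;
  chb : half_braiding cob
}.

Section Center.
Variable M : MonoidalCategory.
Implicit Types x y z : center_ob M.

Definition is_central x y (f : Hom (cob x) (cob y)) : Prop :=
  forall A : M, chb y A \o (f \ot idm A) = (idm A \ot f) \o chb x A.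

Definition center_hom x y : Type := {f : Hom (cob x) (cob y) | is_central f}.

Lemma center_hom_inj x y (f g : center_hom x y) : sval f = sval g -> f = g.
Proof.
case: f g => [f cf] [g cg] /= fg; move: fg cf cg => -> cf cg.
by rewrite (Prop_irrelevance cf cg).
Qed.

Lemma is_central_id x : is_central (idm (cob x)).
Proof. by move=> A; rewrite !tenH_id comp1m compm1. Qed.

Lemma is_central_comp x y z (g : Hom (cob y) (cob z)) (f : Hom (cob x) (cob y)) :
  is_central g -> is_central f -> is_central (g \o f).
Proof.
by move=> cg cf A; rewrite tenH_comp1 compA cg -compA cf compA tenH_1comp.
Qed.

Lemma is_central_inv x y (f : iso (cob x) (cob y)) :
  is_central f -> is_central (f^-1).
Proof.
move=> cf A.
exact/esym/(@iso_sqV _ _ _ _ _ (iso_ten f (iso_id A)) (iso_ten (iso_id A) f)).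
Qed.

Definition center_id x : center_hom x x := exist _ _ (is_central_id x).

Definition center_comp x y z (g : center_hom y z) (f : center_hom x y) :
    center_hom x z :=
  exist _ (sval g \o sval f) (is_central_comp (svalP g) (svalP f)).

Program Definition center : Category :=
  @MkCategory (center_ob M) center_hom center_id center_comp _ _ _.
Next Obligation. by move=> *; apply: center_hom_inj; apply: compA. Qed.
Next Obligation. by move=> *; apply: center_hom_inj; apply: comp1m. Qed.
Next Obligation. by move=> *; apply: center_hom_inj; apply: compm1. Qed.

Lemma unit_braiding_nat (A B : M) (f : Hom A B) :
  ((rho B)^-1 \o lam B) \o (idm unitO \ot f) =
  (f \ot idm unitO) \o ((rho A)^-1 \o lam A).
Proof.
rewrite -compA lam_nat !compA; congr (_ \o _).
exact: (iso_sqV (rho_nat f)).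
Qed.

Lemma unit_braiding_ten (A B : M) :
  (rho (A \ox B))^-1 \o lam (A \ox B) =
  (alpha A B unitO)^-1 \o (idm A \ot ((rho B)^-1 \o lam B))
    \o alpha A unitO B \o (((rho A)^-1 \o lam A) \ot idm B)
    \o (alpha unitO A B)^-1.
Proof. coherence. Qed.

Definition center_unit : center :=
  MkCenterOb (@MkHalfBraiding M unitO
    (fun A => iso_comp (iso_sym (rho A)) (lam A))
    unit_braiding_nat unit_braiding_ten).

End Center.

Section CentralIdempotents.
Variable M : MonoidalCategory.

Local Notation center_slice := (slice (center_unit M)).

(* The morphism [cmor u : cdom u -> I] of the base category that underlies an
   object of the slice of the center over [(I, rho^-1 \o lam)]. *)
Definition cdom (u : center_slice) : center_ob M := projT1 u.

Definition cmor (u : center_slice) : Hom (cob (cdom u)) unitO :=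
  sval (projT2 u).

Record central_idempotent := MkCentralIdempotent {
  ci :> center_slice;
  ci_swap : lam (cdom ci) \o (cmor ci \ot idm (cob (cdom ci))) =
            rho (cdom ci) \o (idm (cob (cdom ci)) \ot cmor ci);
  ci_iso : is_iso (lam (cdom ci) \o (cmor ci \ot idm (cob (cdom ci))))
}.

Definition ci_le (u v : central_idempotent) : Prop :=
  inhabited (@Hom center_slice u v).

Definition ci_eqv (u v : central_idempotent) : Prop :=
  @isomorphic center_slice u v.

Lemma ci_leP (u v : central_idempotent) :
  (exists2 f : Hom (cob (cdom u)) (cob (cdom v)),
     is_central f & cmor v \o f = cmor u) -> ci_le u v.
Proof.
move=> [f cf vf]; constructor.
exists (exist _ f cf : @Hom (center M) (cdom u) (cdom v)).
exact: center_hom_inj.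
Qed.

Lemma ci_leE (u v : central_idempotent) : ci_le u v ->
  exists2 f : Hom (cob (cdom u)) (cob (cdom v)),
     is_central f & cmor v \o f = cmor u.
Proof. by case=> -[[f cf] /(congr1 sval) vf]; exists f. Qed.

Lemma ci_le_refl u : ci_le u u.
Proof. by constructor; apply: idm. Qed.

Lemma ci_le_trans v u w : ci_le u v -> ci_le v w -> ci_le u w.
Proof. by move=> [f] [g]; constructor; apply: (g \o f). Qed.

Lemma ci_endo (u : central_idempotent) (f : @Hom center_slice u u) : f = idm _.
Proof.
apply/slice_hom_inj/center_hom_inj.
have /(congr1 sval) : projT2 (ci u) \o sval f = projT2 (ci u) := svalP f.
rewrite /= -/(cmor u); move: (sval (sval f)) => {}f fu.
have [m mE] := iso_of_isiso (ci_iso u).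
apply: (iso_epi (f := m)); rewrite mE.
transitivity (lam (cdom u) \o cmor u \ot idm (cob (cdom u)) \o (idm _ \ot f)).
  by rewrite !compA -lam_nat -!compA -tenH_split' -tenH_split.
by rewrite ci_swap -compA -tenH_1comp fu comp1m.
Qed.

Lemma ci_eqvE u v : ci_eqv u v <-> ci_le u v /\ ci_le v u.
Proof.
split=> [[f [g _]]|[[f] [g]]]; first by split; constructor.
by exists f, g; split; apply: ci_endo.
Qed.

End CentralIdempotents.

Ltac tr_push :=
  repeat lazymatch goal with
  | |- context [@tr ?M ?A ?C ?r ?t (@compm _ _ ?B _ ?g ?f) ?X] =>
      let s := reading_of B in rewrite (@tr_comp M A B C r s t g f X)
  | |- context [tr _ _ (tenH _ _) _] => rewrite tr_ten
  | |- context [tr _ _ (idm _) _] => rewrite tr_id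
  | |- context [tr _ _ (isom (alpha _ _ _)) _] => rewrite tr_alpha
  | |- context [tr _ _ (isoinv (alpha _ _ _)) _] => rewrite tr_alphaV
  | |- context [tr _ _ (isom (lam _)) _] => rewrite tr_lam
  | |- context [tr _ _ (isoinv (lam _)) _] => rewrite tr_lamV
  | |- context [tr _ _ (isom (rho _)) _] => rewrite tr_rho
  | |- context [tr _ _ (isoinv (rho _)) _] => rewrite tr_rhoV
  end;
  rewrite /= ?lift_ten ?lift_gen ?lift_one /= ?lift_id ?tenH_id
    ?comp1m ?compm1 ?tenH_1comp.

(* Moves an equality of morphisms to the strict world of readings. *)
Ltac strictify X :=
  lazymatch goal with
  | |- @eq (@Hom _ ?A ?B) _ _ =>
      let r := reading_of A in let s := reading_of B in
      apply: (@tr_inj _ _ _ r s) => X; tr_push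
  end.

Section HalfBraidingReading.
Variables (M : MonoidalCategory) (U : M) (s : half_braiding U).
Local Notation r := (rgen _).

Definition hbt (A : M) (a : reading A) (X : M) :
    Hom (U \ox act a X) (act a (U \ox X)) :=
  tr (rten (rgen U) a) (rten a (rgen U)) (s A) X.

Lemma hbtE A (a : reading A) X :
  tr (rten (rgen U) a) (rten a (rgen U)) (s A) X = hbt a X.
Proof. by []. Qed.

Lemma hbt_nat A B (a : reading A) (b : reading B) (f : Hom A B) X :
  hbt b X \o (idm U \ot tr a b f X) = tr a b f (U \ox X) \o hbt a X.
Proof.
have /(congr1 (fun h => tr (rten (rgen U) a) (rten b (rgen U)) h X)) :=
  hb_nat s f.
rewrite (tr_comp _ (rten (rgen U) b)) (tr_comp _ (rten a (rgen U))) !hbtE.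
by rewrite !tr_ten !tr_id lift_gen lift_id comp1m compm1.
Qed.

Lemma hbt_lift A (a : reading A) X Y (h : Hom X Y) :
  hbt a Y \o (idm U \ot lift a h) = lift a (idm U \ot h) \o hbt a X.
Proof.
have := tr_nat (rten (rgen U) a) (rten a (rgen U)) (s A) h.
by rewrite !lift_ten !lift_gen.
Qed.

Lemma hbt_ten A B (a : reading A) (b : reading B) X :
  hbt (rten a b) X = lift a (hbt b X) \o hbt a (act b X).
Proof.
rewrite /hbt hb_ten.
rewrite (tr_comp _ (rten (rten (rgen U) a) b)) tr_alphaV compm1.
rewrite (tr_comp _ (rten (rten a (rgen U)) b)).
rewrite (tr_comp _ (rten a (rten (rgen U) b))) tr_alpha compm1.
rewrite (tr_comp _ (rten a (rten b (rgen U)))) tr_alphaV comp1m.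
by rewrite !tr_ten !tr_id lift_id comp1m compm1.
Qed.

Lemma hbt_one X : hbt rone X = idm (U \ox X).
Proof.
have e : hbt (rten rone rone) X = hbt rone X.
  have := hbt_nat (rten rone rone) rone (lam unitO) X.
  by rewrite !tr_lam tenH_id compm1 comp1m.
have {}e : hbt rone X \o hbt rone X = hbt rone X.
  by rewrite -[RHS]e hbt_ten lift_one.
have [_ h] := tr_inv (rten (rgen U) rone) (rten rone (rgen U)) (s unitO) X.
by by rewrite -[LHS]comp1m -h -compA hbtE e -hbtE h.
Qed.

End HalfBraidingReading.

Section CenterTensor.
Variable M : MonoidalCategory.

Section HalfBraidingTensor.
Variables (U V : M) (s : half_braiding U) (t : half_braiding V).

Definition ten_braiding (A : M) : iso ((U \ox V) \ox A) (A \ox (U \ox V)) :=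
  iso_comp (alpha A U V)
    (iso_comp (iso_ten (s A) (iso_id V))
      (iso_comp (iso_sym (alpha U A V))
        (iso_comp (iso_ten (iso_id U) (t A)) (alpha U V A)))).

Lemma ten_braidingE A (a : reading A) X :
  tr (rten (rten (rgen U) (rgen V)) a) (rten a (rten (rgen U) (rgen V)))
    (ten_braiding A) X = hbt s a (V \ox X) \o (idm U \ot hbt t a X).
Proof.
rewrite /ten_braiding /=.
rewrite (tr_comp _ (rten (rten a (rgen U)) (rgen V))) tr_alpha comp1m.
rewrite (tr_comp _ (rten (rten (rgen U) a) (rgen V))).
rewrite (tr_comp _ (rten (rgen U) (rten a (rgen V)))) tr_alphaV comp1m.
rewrite (tr_comp _ (rten (rgen U) (rten (rgen V) a))) tr_alpha compm1.
by rewrite !tr_ten !tr_id lift_id lift_gen comp1m compm1.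
Qed.

Lemma ten_braiding_nat (A B : M) (f : Hom A B) :
  ten_braiding B \o (idm (U \ox V) \ot f) =
  (f \ot idm (U \ox V)) \o ten_braiding A.
Proof.
strictify X; rewrite !ten_braidingE -!compA.
rewrite -tenH_1comp (hbt_nat t (rgen A) (rgen B)) tenH_1comp.
by rewrite compA (hbt_nat s (rgen A) (rgen B) f (V \ox X)) -compA.
Qed.

Lemma ten_braiding_ten (A B : M) :
  ten_braiding (A \ox B) =
  (alpha A B (U \ox V))^-1 \o (idm A \ot ten_braiding B)
    \o alpha A (U \ox V) B \o (ten_braiding A \ot idm B)
    \o (alpha (U \ox V) A B)^-1 :> Hom _ _.
Proof.
strictify X; rewrite !ten_braidingE !hbt_ten !lift_gen /= -!compA !tenH_1comp.
rewrite -!compA; congr (_ \o _); rewrite !compA; congr (_ \o _).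
by have := hbt_lift s (rgen A) (hbt t (rgen B) X); rewrite !lift_gen => <-.
Qed.

Definition ten_half_braiding : half_braiding (U \ox V) :=
  MkHalfBraiding ten_braiding_nat ten_braiding_ten.

End HalfBraidingTensor.

Definition center_ten (x y : center_ob M) : center_ob M :=
  MkCenterOb (ten_half_braiding (chb x) (chb y)).

Lemma tr_central (x y : center_ob M) (f : Hom (cob x) (cob y))
    (A : M) (a : reading A) X : is_central f ->
  hbt (chb y) a X \o tr (rgen (cob x)) (rgen (cob y)) f (act a X) =
  lift a (tr (rgen (cob x)) (rgen (cob y)) f X) \o hbt (chb x) a X.
Proof.
move=> /(_ A) /(congr1 (fun h =>
  tr (rten (rgen (cob x)) a) (rten a (rgen (cob y))) h X)).
rewrite (tr_comp _ (rten (rgen (cob y)) a)) (tr_comp _ (rten a (rgen (cob x)))).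
by rewrite !tr_ten !tr_id lift_id compm1 comp1m !hbtE.
Qed.

Lemma central_ten (x x' y y' : center_ob M)
    (f : Hom (cob x) (cob x')) (g : Hom (cob y) (cob y')) :
  is_central f -> is_central g ->
  @is_central M (center_ten x y) (center_ten x' y') (f \ot g).
Proof.
move=> cf cg A /=; strictify X; rewrite !hbtE -!compA.
rewrite (compA (idm _ \ot _)).
have := tr_nat (rgen (cob x)) (rgen (cob x')) f (hbt (chb y') (rgen A) X).
rewrite !lift_gen /= => <-; rewrite -!compA -tenH_1comp.
have /= -> := tr_central (rgen A) X cg; rewrite lift_gen tenH_1comp.
rewrite compA; have /= -> := tr_central (rgen A) (cob y' \ox X) cf.
rewrite lift_gen -!compA; congr (_ \o _); rewrite !compA; congr (_ \o _).
by have := hbt_lift (chb x) (rgen A) (tr (rgen _) (rgen (cob y')) g X);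
  rewrite !lift_gen => <-.
Qed.

Lemma central_lam (x : center_ob M) :
  @is_central M (center_ten (center_unit M) x) x (lam (cob x)).
Proof. by move=> A /=; strictify X. Qed.

Lemma central_rho (x : center_ob M) :
  @is_central M (center_ten x (center_unit M)) x (rho (cob x)).
Proof. by move=> A /=; strictify X; rewrite tenH_id compm1. Qed.

End CenterTensor.

Section Meet.
Variable M : MonoidalCategory.
Local Notation center_slice := (slice (center_unit M)).

Lemma cmor_central (u : center_slice) :
  @is_central M (cdom u) (center_unit M) (cmor u).
Proof. exact: svalP (projT2 u). Qed.

Definition cred (u : center_slice) (X : M) : Hom (cob (cdom u) \ox X) X :=
  tr (rgen (cob (cdom u))) rone (cmor u) X.

Lemma cred_nat (u : center_slice) (X Y : M) (h : Hom X Y) :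
  cred u Y \o (idm _ \ot h) = h \o cred u X.
Proof.
by have := tr_nat (rgen (cob (cdom u))) rone (cmor u) h;
  rewrite lift_gen lift_one.
Qed.

Lemma cred_central (u : center_slice) (A X : M) (a : reading A) :
  lift a (cred u X) \o hbt (chb (cdom u)) a X = cred u (act a X).
Proof.
have := cmor_central u A.
move=> /(congr1 (fun h => tr (rten (rgen (cob (cdom u))) a) (rten a rone) h X)).
rewrite /= (tr_comp _ (rten rone a)) (tr_comp _ a) tr_lam tr_rhoV.
rewrite (tr_comp _ (rten a (rgen (cob (cdom u))))) !tr_ten !tr_id lift_id.
by rewrite !comp1m !compm1 hbtE => <-.
Qed.

Lemma hbt_cred (u : center_slice) (V : M) (s : half_braiding V) (X : M) :
  cred u (V \ox X) \o hbt s (rgen (cob (cdom u))) X = idm V \ot cred u X.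
Proof.
have := hbt_nat s (rgen (cob (cdom u))) rone (cmor u) X.
by rewrite hbt_one comp1m => <-.
Qed.

Lemma cred_swap (u : central_idempotent M) (X : M) :
  cred u (cob (cdom u) \ox X) = idm _ \ot cred u X.
Proof.
have /(congr1 (fun h => tr (rten (rgen _) (rgen _)) (rgen _) h X)) := ci_swap u.
rewrite (tr_comp _ (rten rone (rgen _))) (tr_comp _ (rten (rgen _) rone)).
by rewrite tr_lam tr_rho !tr_ten !tr_id lift_id lift_gen !comp1m compm1.
Qed.

Definition top_slice : center_slice :=
  existT (fun x : center M => @Hom (center M) x (center_unit M))
    (center_unit M) (idm (center_unit M)).

Lemma top_swap :
  lam (cob (cdom top_slice)) \o (cmor top_slice \ot idm (cob (cdom top_slice))) =
  rho (cob (cdom top_slice)) \o (idm (cob (cdom top_slice)) \ot cmor top_slice).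
Proof. by rewrite /cmor /=; coherence. Qed.

Lemma top_iso : is_iso
  (lam (cob (cdom top_slice)) \o (cmor top_slice \ot idm (cob (cdom top_slice)))).
Proof. by rewrite /cmor /= tenH_id compm1; apply: iso_isiso. Qed.

Definition ci_top : central_idempotent M :=
  MkCentralIdempotent top_swap top_iso.

Lemma ci_le_top (u : central_idempotent M) : ci_le u ci_top.
Proof.
by apply: ci_leP; exists (cmor u); [apply: cmor_central|rewrite /cmor /= comp1m].
Qed.

Section MeetOf.
Variables u v : central_idempotent M.
Local Notation U := (cob (cdom u)).
Local Notation V := (cob (cdom v)).

Lemma meet_central :
  @is_central M (center_ten (cdom u) (cdom v)) (center_unit M)
    (lam unitO \o (cmor u \ot cmor v)).
Proof.
apply: (@is_central_comp _ _ (center_ten (center_unit M) (center_unit M))).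
  exact: (central_lam (center_unit M)).
apply: central_ten; exact: cmor_central.
Qed.

Definition meet_slice : center_slice :=
  existT (fun x : center M => @Hom (center M) x (center_unit M))
    (center_ten (cdom u) (cdom v)) (exist _ _ meet_central).

Lemma meet_tr X :
  tr (rten (rgen U) (rgen V)) rone (cmor meet_slice) X =
  cred u X \o (idm U \ot cred v X).
Proof.
by rewrite /cmor /= (tr_comp _ (rten rone rone)) tr_lam comp1m tr_ten lift_gen.
Qed.

Lemma meet_swap :
  lam (cob (cdom meet_slice)) \o
    (cmor meet_slice \ot idm (cob (cdom meet_slice))) =
  rho (cob (cdom meet_slice)) \o
    (idm (cob (cdom meet_slice)) \ot cmor meet_slice).
Proof.
apply: (@tr_inj _ _ _
  (rten (rten (rgen U) (rgen V)) (rten (rgen U) (rgen V)))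
  (rten (rgen U) (rgen V))) => X.
rewrite (tr_comp _ (rten rone (rten (rgen U) (rgen V)))) tr_lam comp1m.
rewrite (tr_comp _ (rten (rten (rgen U) (rgen V)) rone)) tr_rho comp1m.
rewrite !tr_ten !tr_id !meet_tr lift_id compm1 comp1m lift_ten !lift_gen /=.
rewrite cred_swap -(cred_central v (V \ox X) (rgen U)) lift_gen cred_swap.
rewrite -tenH_1comp compA (cred_nat u (idm V \ot cred v X)) -compA.
rewrite (hbt_cred u (chb (cdom v))) -tenH_1comp.
by rewrite cred_nat.
Qed.

Lemma meet_iso : is_iso (lam (cob (cdom meet_slice)) \o
  (cmor meet_slice \ot idm (cob (cdom meet_slice)))).
Proof.
pose k := iso_comp (iso_sym (alpha U U (V \ox V)))
  (iso_comp (iso_ten (iso_id U) (iso_comp (alpha U V V)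
    (iso_comp (iso_ten (chb (cdom v) U) (iso_id V))
      (iso_sym (alpha V U V))))) (alpha U V (U \ox V))).
have -> : lam (cob (cdom meet_slice)) \o
    (cmor meet_slice \ot idm (cob (cdom meet_slice))) =
    ((lam U \o (cmor u \ot idm U)) \ot (lam V \o (cmor v \ot idm V))) \o k.
  rewrite /k /=; apply: (@tr_inj _ _ _
    (rten (rten (rgen U) (rgen V)) (rten (rgen U) (rgen V)))
    (rten (rgen U) (rgen V))) => X.
  rewrite (tr_comp _ (rten rone (rten (rgen U) (rgen V)))) tr_lam comp1m.
  rewrite tr_ten tr_id lift_id compm1 meet_tr /=; tr_push.
  rewrite -compA -tenH_1comp hbtE.
  by have := cred_central v (V \ox X) (rgen U); rewrite lift_gen => <-.
apply: is_iso_comp; last exact: iso_isiso.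
by apply: is_iso_ten; apply: ci_iso.
Qed.

Definition ci_meet : central_idempotent M :=
  MkCentralIdempotent meet_swap meet_iso.

Lemma ci_meet_l : ci_le ci_meet u.
Proof.
apply: ci_leP; exists (rho U \o (idm U \ot cmor v)).
  apply: (@is_central_comp _ _ (center_ten (cdom u) (center_unit M))).
    exact: central_rho.
  apply: central_ten; [exact: is_central_id|exact: cmor_central].
rewrite [RHS]/cmor /= compA -rho_nat -compA -tenH_comp compm1 comp1m.
by congr (_ \o _); coherence.
Qed.

Lemma ci_meet_r : ci_le ci_meet v.
Proof.
apply: ci_leP; exists (lam V \o (cmor u \ot idm V)).
  apply: (@is_central_comp _ _ (center_ten (center_unit M) (cdom v))).
    exact: central_lam.
  apply: central_ten; [exact: cmor_central|exact: is_central_id].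
by rewrite [RHS]/cmor /= compA -lam_nat -compA -tenH_comp compm1 comp1m.
Qed.

Lemma ci_meet_glb (w : central_idempotent M) :
  ci_le w u -> ci_le w v -> ci_le w ci_meet.
Proof.
move=> /ci_leE[f cf uf] /ci_leE[g cg vg].
have [m mE] := iso_of_isiso (ci_iso w).
have cm : @is_central M (center_ten (cdom w) (cdom w)) (cdom w) m.
  rewrite mE.
  apply: (@is_central_comp _ _ (center_ten (center_unit M) (cdom w))).
    exact: central_lam.
  apply: central_ten; [exact: cmor_central|exact: is_central_id].
apply: ci_leP; exists ((f \ot g) \o m^-1).
  apply: (@is_central_comp _ _ (center_ten (cdom w) (cdom w))).
    exact: central_ten.
  exact: is_central_inv cm.
rewrite -[LHS]/((lam unitO \o (cmor u \ot cmor v)) \o ((f \ot g) \o m^-1)).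
rewrite -compA (compA _ (f \ot g)) -tenH_comp uf vg.
apply: (iso_epi (f := m)); rewrite -!compA isoK compm1 mE.
rewrite tenH_split' !compA lam_nat.
by [].
Qed.

End MeetOf.
End Meet.

Section ZI.
Variable M : MonoidalCategory.
Implicit Types u v w : central_idempotent M.

HB.instance Definition _ := gen_eqMixin (central_idempotent M).
HB.instance Definition _ := gen_choiceMixin (central_idempotent M).

Definition ci_eqvb u v : bool := `[< ci_eqv u v >].

Lemma ci_eqvb_refl : reflexive ci_eqvb.
Proof. by move=> u; apply/asboolP/ci_eqvE; split; apply: ci_le_refl. Qed.

Lemma ci_eqvb_sym : symmetric ci_eqvb.
Proof.
by move=> u v; apply/asboolP/asboolP => /ci_eqvE[uv vu]; apply/ci_eqvE.
Qed.

Lemma ci_eqvb_trans : transitive ci_eqvb.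
Proof.
move=> v u w /asboolP/ci_eqvE[uv vu] /asboolP/ci_eqvE[vw wv].
by apply/asboolP/ci_eqvE; split; apply: (ci_le_trans (v := v)).
Qed.

Canonical ci_equiv := EquivRel ci_eqvb ci_eqvb_refl ci_eqvb_sym ci_eqvb_trans.

Definition ZI : Type := {eq_quot ci_equiv}.

HB.instance Definition _ := Choice.on ZI.
HB.instance Definition _ := EqQuotient.on ZI.

Lemma ZI_eqP u v : reflect (ci_eqv u v) (\pi_ZI u == \pi_ZI v).
Proof. by rewrite piE; apply: asboolP. Qed.

(* Defined on representatives; [ZI_le_pi] and [ZI_meet_pi] show that the choice
   of representatives does not matter. *)
Definition ZI_le (x y : ZI) : bool := `[< ci_le (repr x) (repr y) >].

Definition ZI_meet (x y : ZI) : ZI := \pi_ZI (ci_meet (repr x) (repr y)).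

Definition ZI_top : ZI := \pi_ZI (ci_top M).

Lemma ci_eqv_repr u : ci_eqv (repr (\pi_ZI u)) u.
Proof. by apply/ZI_eqP; rewrite reprK. Qed.

Lemma ZI_le_pi u v : ZI_le (\pi_ZI u) (\pi_ZI v) = `[< ci_le u v >].
Proof.
have /ci_eqvE[u1 u2] := ci_eqv_repr u; have /ci_eqvE[v1 v2] := ci_eqv_repr v.
apply/asboolP/asboolP => uv.
  exact: ci_le_trans u2 (ci_le_trans uv v1).
exact: ci_le_trans u1 (ci_le_trans uv v2).
Qed.

Lemma ZI_meet_pi u v : ZI_meet (\pi_ZI u) (\pi_ZI v) = \pi_ZI (ci_meet u v).
Proof.
have /ci_eqvE[u1 u2] := ci_eqv_repr u; have /ci_eqvE[v1 v2] := ci_eqv_repr v.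
apply/eqP/ZI_eqP/ci_eqvE; split; apply: ci_meet_glb.
- exact: ci_le_trans (ci_meet_l _ _) u1.
- exact: ci_le_trans (ci_meet_r _ _) v1.
- exact: ci_le_trans (ci_meet_l _ _) u2.
- exact: ci_le_trans (ci_meet_r _ _) v2.
Qed.

Lemma ZI_le_refl : reflexive ZI_le.
Proof. by move=> x; apply/asboolP/ci_le_refl. Qed.

Lemma ZI_le_anti : antisymmetric ZI_le.
Proof.
move=> x y /andP[/asboolP xy /asboolP yx].
by rewrite -[x]reprK -[y]reprK; apply/eqP/ZI_eqP/ci_eqvE.
Qed.

Lemma ZI_le_trans : transitive ZI_le.
Proof.
by move=> y x z /asboolP xy /asboolP yz; apply/asboolP/(ci_le_trans xy yz).
Qed.

Fact ZI_display : Order.disp_t. Proof. exact: (Order.Disp tt tt). Qed.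

HB.instance Definition _ :=
  Order.Le_isPOrder.Build ZI_display ZI ZI_le_refl ZI_le_anti ZI_le_trans.

Lemma ZI_lexI (x y z : ZI) :
  (x <= ZI_meet y z)%O = (x <= y)%O && (x <= z)%O.
Proof.
rewrite -[x]reprK -[y]reprK -[z]reprK ZI_meet_pi.
rewrite /Order.le /= !ZI_le_pi.
apply/asboolP/andP => [h|[/asboolP xy /asboolP xz]]; last exact: ci_meet_glb.
by split; apply/asboolP; apply: ci_le_trans h _;
  [apply: ci_meet_l|apply: ci_meet_r].
Qed.

HB.instance Definition _ :=
  Order.POrder_isMeetSemilattice.Build ZI_display ZI ZI_lexI.

Lemma ZI_lex1 (x : ZI) : (x <= ZI_top)%O.
Proof.
by rewrite -[x]reprK /Order.le /= ZI_le_pi; apply/asboolP/ci_le_top.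
Qed.

HB.instance Definition _ := Order.hasTop.Build ZI_display ZI ZI_lex1.

End ZI.

(* Main.v *)
(** Tensoring sequences together is a fully faithful strong monoidal functor
    from the strictification to C, with structure isomorphisms lbprod_cat.
    Conjugation by these turns half-braidings on a sequence S into half-braidings
    on its tensor product lbprod S and back: a half-braiding in the
    strictification is determined, by naturality, by its components at one-term
    sequences.  Centrality of a morphism, the swap equation of a central
    idempotent and its invertibility condition are all invariant under this
    conjugation, so u |-> ([:: U], u) is an order isomorphism, and order
    isomorphisms preserve meets and top elements. *)

From mathcomp Require Import all_boot all_order.
From mathcomp Require Import generic_quotient boolp.
Require Import Defs.

Set Implicit Arguments.
Unset Strict Implicit.
Unset Printing Implicit Defensive.
Import Order.TTheory.
Local Open Scope cat_scope.
Local Open Scope quotient_scope.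

Section HalfBraidingTransport.
Variable C : BraidedMonoidalCategory.
Implicit Types S T U : seq C.

(** * Conjugation by the concatenation isomorphisms *)

Definition cat_conj S T
    (h : Hom (lbprod S \ox lbprod T) (lbprod T \ox lbprod S)) :
    Hom (lbprod (S ++ T)) (lbprod (T ++ S)) :=
  lbprod_cat T S \o (h \o (lbprod_cat S T)^-1).

(** Once the inner [lbprod_cat] cancel, the two equations differ only by isomorphisms at both ends.
    With [f] an identity this transports naturality of half-braidings, with [g] an identity it
    transports centrality. *)
Lemma cat_conj_nat S S' T T' (f : Hom (lbprod S) (lbprod S'))
    (g : Hom (lbprod T) (lbprod T'))
    (h : Hom (lbprod S \ox lbprod T) (lbprod T \ox lbprod S))
    (k : Hom (lbprod S' \ox lbprod T') (lbprod T' \ox lbprod S')) :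
  cat_conj k \o strict_tenH f g = strict_tenH g f \o cat_conj h <->
  k \o (f \ot g) = (g \ot f) \o h.
Proof.
rewrite /strict_tenH /cat_conj -!compA !compK; split=> [/iso_mono|e].
  by rewrite !compA => /(iso_epi (f := iso_sym (lbprod_cat S T))).
by rewrite (compE _ e).
Qed.

(** Moving the strict associators past the concatenation isomorphisms turns them into those of [C].
    Since [hT] and [hU] are arbitrary, the hexagon can be carried in both directions. *)
Lemma cat_conj_hexagon S T U
    (hT : Hom (lbprod S \ox lbprod T) (lbprod T \ox lbprod S))
    (hU : Hom (lbprod S \ox lbprod U) (lbprod U \ox lbprod S)) :
  ((strict_alpha T U S)^-1 : Hom (lbprod _) (lbprod _)) \o
      strict_tenH (idm (lbprod T)) (cat_conj hU) \o
      (isom (strict_alpha T S U) : Hom (lbprod _) (lbprod _)) \o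
      strict_tenH (cat_conj hT) (idm (lbprod U)) \o
      ((strict_alpha S T U)^-1 : Hom (lbprod _) (lbprod _)) \o
    (lbprod_cat S (T ++ U) \o (idm (lbprod S) \ot lbprod_cat T U)) =
  lbprod_cat (T ++ U) S \o (lbprod_cat T U \ot idm (lbprod S)) \o
    ((alpha _ _ _)^-1 \o (idm (lbprod T) \ot hU) \o alpha _ _ _ \o
      (hT \ot idm (lbprod U)) \o (alpha _ _ _)^-1).
Proof.
rewrite /strict_tenH -!compA strict_alphaV_cat compK.
rewrite tenH_comp1E /cat_conj -!compA isoK compm1 tenH_comp1 -!compA.
rewrite strict_alpha_catE compK tenH_1compE -!compA isoK compm1 tenH_1comp.
by rewrite -!compA strict_alphaV_catE.
Qed.

(** * Half-braidings on [lbprod S] give half-braidings on [S] *)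

Section Strictify.
Variables (S : seq C) (s : half_braiding (lbprod S)).

Definition strict_hb T : iso ((S ++ T) : strict_category C) (T ++ S) :=
  let f := iso_comp (lbprod_cat T S)
             (iso_comp (s (lbprod T)) (iso_sym (lbprod_cat S T))) in
  @MkIso (strict_category C) (S ++ T) (T ++ S) f (f^-1) (isoK f) (isoVK f).

Lemma strict_hb_nat T U (f : Hom (lbprod T) (lbprod U)) :
  (isom (strict_hb U) : Hom (lbprod _) (lbprod _)) \o
    strict_tenH (idm (lbprod S)) f =
  strict_tenH f (idm (lbprod S)) \o
    (isom (strict_hb T) : Hom (lbprod _) (lbprod _)).
Proof.
by apply/(cat_conj_nat (idm (lbprod S)) f); apply: hb_nat.
Qed.

(** The hexagon of [s] concerns [lbprod T \ox lbprod U]; naturality of [s] along [lbprod_cat T U]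
    carries it to [lbprod (T ++ U)]. *)
Lemma strict_hb_ten T U :
  (isom (strict_hb (T ++ U)) : Hom (lbprod _) (lbprod _)) =
  ((strict_alpha T U S)^-1 : Hom (lbprod _) (lbprod _)) \o
      strict_tenH (idm (lbprod T))
        (isom (strict_hb U) : Hom (lbprod _) (lbprod _)) \o
      (isom (strict_alpha T S U) : Hom (lbprod _) (lbprod _)) \o
      strict_tenH (isom (strict_hb T) : Hom (lbprod _) (lbprod _))
        (idm (lbprod U)) \o
      ((strict_alpha S T U)^-1 : Hom (lbprod _) (lbprod _)).
Proof.
apply: (iso_epi (f := iso_comp (lbprod_cat S (T ++ U))
  (iso_ten (iso_id (lbprod S)) (lbprod_cat T U)))).
rewrite (cat_conj_hexagon (s (lbprod T)) (s (lbprod U))) -hb_ten.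
by rewrite /= -!compA compK hb_nat.
Qed.

Definition strict_half_braiding : @half_braiding (strict_monoidal C) S :=
  @MkHalfBraiding (strict_monoidal C) S strict_hb strict_hb_nat strict_hb_ten.

End Strictify.

(** * Half-braidings on [S] give half-braidings on [lbprod S] *)

Section Unstrictify.
Variables (S : seq C) (t : @half_braiding (strict_monoidal C) S).

Definition strict_hb_iso T : iso (lbprod (S ++ T)) (lbprod (T ++ S)) :=
  @MkIso C (lbprod (S ++ T)) (lbprod (T ++ S)) (t T) ((t T)^-1)
    (isoK (t T)) (isoVK (t T)).

Definition lb_hb T : iso (lbprod S \ox lbprod T) (lbprod T \ox lbprod S) :=
  iso_comp (iso_sym (lbprod_cat T S))
    (iso_comp (strict_hb_iso T) (lbprod_cat S T)).

Lemma lb_hbK T : cat_conj (lb_hb T) = strict_hb_iso T.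
Proof. by rewrite /cat_conj /= -!compA isoVK compm1 compVK. Qed.

Lemma lb_hb_nat T U (f : Hom (lbprod T) (lbprod U)) :
  lb_hb U \o (idm (lbprod S) \ot f) = (f \ot idm (lbprod S)) \o lb_hb T.
Proof.
by apply/cat_conj_nat; rewrite !lb_hbK; apply: (hb_nat t f).
Qed.

Lemma lb_hb_ten T U :
  lb_hb (T ++ U) \o (idm (lbprod S) \ot lbprod_cat T U) =
  (lbprod_cat T U \ot idm (lbprod S)) \o
    ((alpha _ _ _)^-1 \o (idm (lbprod T) \ot lb_hb U) \o alpha _ _ _ \o
      (lb_hb T \ot idm (lbprod U)) \o (alpha _ _ _)^-1).
Proof.
apply: (iso_mono (f := lbprod_cat (T ++ U) S)); rewrite [RHS]compA.
rewrite -cat_conj_hexagon !lb_hbK.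
transitivity (strict_hb_iso (T ++ U) \o
  (lbprod_cat S (T ++ U) \o (idm (lbprod S) \ot lbprod_cat T U))).
  by rewrite /= -!compA compVK.
by congr (_ \o _); apply: (hb_ten t T U).
Qed.

Lemma lb_hb_ten1 (A B : C) :
  isom (lb_hb [:: A \ox B]) = (alpha A B (lbprod S))^-1 \o
    (idm A \ot lb_hb [:: B]) \o alpha A (lbprod S) B \o
    (lb_hb [:: A] \ot idm B) \o (alpha (lbprod S) A B)^-1.
Proof.
(* [A \ox B] is both [lbprod [:: A; B]] and [lbprod [:: A \ox B]], so its
   identity is an isomorphism between these two sequences; and [lbprod_cat] of
   two one-term sequences is an identity. *)
have := @lb_hb_nat [:: A; B] [:: A \ox B] (idm (A \ox B)).
have := lb_hb_ten [:: A] [:: B].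
by rewrite /= !tenH_id !comp1m !compm1 => -> ->.
Qed.

Definition lb_half_braiding : half_braiding (lbprod S) :=
  @MkHalfBraiding C (lbprod S) (fun A => lb_hb [:: A])
    (fun A B => @lb_hb_nat [:: A] [:: B]) lb_hb_ten1.

(** [T] and [[:: lbprod T]] have the same tensor product, so its identity is a morphism between them
    in the strictification; naturality along it equates the two components. *)
Lemma lb_half_braidingE T : isom (lb_half_braiding (lbprod T)) = lb_hb T.
Proof.
have := @lb_hb_nat T [:: lbprod T] (idm (lbprod T)).
by rewrite !tenH_id comp1m compm1.
Qed.

End Unstrictify.

Lemma strict_half_braidingK S (s : half_braiding (lbprod S)) A :
  isom (lb_half_braiding (strict_half_braiding s) A) = s A.
Proof. by rewrite /= -!compA isoK compm1 compK. Qed.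

(** * Objects and morphisms of the two centers *)

Definition lb_center_ob (x : center_ob (strict_monoidal C)) : center_ob C :=
  MkCenterOb (lb_half_braiding (chb x)).

(** Centrality in [C] tests one-term sequences only; [lb_half_braidingE] extends it to every [T]. *)
Lemma is_central_lb (x y : center_ob (strict_monoidal C))
    (f : Hom (lbprod (cob x)) (lbprod (cob y))) :
  @is_central (strict_monoidal C) x y f <->
  @is_central C (lb_center_ob x) (lb_center_ob y) f.
Proof.
split=> cf T.
  apply/(@cat_conj_nat _ _ [:: T] [:: T] f (idm T)); rewrite !lb_hbK.
  exact: (cf [:: T]).
have : cat_conj (lb_hb (chb y) T) \o strict_tenH f (idm (lbprod T)) =
    strict_tenH (idm (lbprod T)) f \o cat_conj (lb_hb (chb x) T).
  by apply/cat_conj_nat; rewrite -!lb_half_braidingE; apply: cf.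
by rewrite !lb_hbK.
Qed.

(** The strict unitors are identities at [[:: A]]; [rho A] and [lam A] arise as [lbprod_cat] with an
    empty sequence on one side. *)
Lemma lb_center_unit A :
  isom (chb (lb_center_ob (center_unit (strict_monoidal C))) A) =
  (rho A)^-1 \o lam A.
Proof.
have rhoE : (strict_rho [:: A])^-1 = idm A
    :> Hom (lbprod [:: A]) (lbprod [:: A]).
  by rewrite strict_eqtoisoV (Prop_irrelevance (congr1 _ _) erefl).
have lamE : isom (strict_lam [:: A]) = idm A
    :> Hom (lbprod [:: A]) (lbprod [:: A]).
  by rewrite strict_eqtoiso (Prop_irrelevance (congr1 _ _) erefl).
transitivity ((rho A)^-1 \o
    (((strict_rho [:: A])^-1 : Hom (lbprod [:: A]) (lbprod [:: A])) \o
     (isom (strict_lam [:: A]) : Hom (lbprod [:: A]) (lbprod [:: A])) \o lam A)).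
  by [].
by rewrite rhoE lamE !comp1m.
Qed.

Lemma is_central_lb_unit (x : center_ob (strict_monoidal C))
    (f : Hom (lbprod (cob x)) unitO) :
  @is_central (strict_monoidal C) x (center_unit _) f <->
  @is_central C (lb_center_ob x) (center_unit C) f.
Proof.
split=> [/is_central_lb|] cf; last apply/is_central_lb.
  by move=> A; have := cf A; rewrite lb_center_unit.
by move=> A; rewrite lb_center_unit; apply: cf.
Qed.

Definition strict_center_ob (x : center_ob C) : center_ob (strict_monoidal C) :=
  MkCenterOb (strict_half_braiding (S := [:: cob x]) (chb x)).

Lemma is_central_strict (x y : center_ob C) (f : Hom (cob x) (cob y)) :
  @is_central (strict_monoidal C) (strict_center_ob x) (strict_center_ob y) f <->
  is_central f.
Proof.
split=> [/is_central_lb|] cf; last apply/is_central_lb.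
  by move=> A; have := cf A; rewrite !strict_half_braidingK.
by move=> A; rewrite !strict_half_braidingK; apply: cf.
Qed.

Lemma is_central_strict_unit (x : center_ob C) (f : Hom (cob x) unitO) :
  @is_central (strict_monoidal C) (strict_center_ob x) (center_unit _) f <->
  @is_central C x (center_unit C) f.
Proof.
split=> [/is_central_lb_unit|] cf; last apply/is_central_lb_unit.
  by move=> A; have := cf A; rewrite !strict_half_braidingK.
by move=> A; rewrite !strict_half_braidingK; apply: cf.
Qed.

(** * The swap equation and its invertibility condition *)

Section Idempotency.
Variables (S : seq C) (f : Hom (lbprod S) (lbprod [::])).

Lemma strict_lam_act :
  (isom (strict_lam S) : Hom (lbprod _) (lbprod _)) \o
    strict_tenH f (idm (lbprod S)) =
  lam (lbprod S) \o (f \ot idm (lbprod S)) \o (lbprod_cat S S)^-1.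
Proof.
by rewrite strict_eqtoiso (Prop_irrelevance (congr1 _ _) erefl) comp1m.
Qed.

Lemma strict_rho_act :
  (isom (strict_rho S) : Hom (lbprod _) (lbprod _)) \o
    strict_tenH (idm (lbprod S)) f =
  rho (lbprod S) \o (idm (lbprod S) \ot f) \o (lbprod_cat S S)^-1.
Proof. by rewrite !compA strict_rho_cat. Qed.

(** Both strict sides are the sides in [C] precomposed with the inverse of [lbprod_cat S S]. *)
Lemma strict_swap :
  (isom (strict_lam S) : Hom (lbprod _) (lbprod _)) \o
    strict_tenH f (idm (lbprod S)) =
  (isom (strict_rho S) : Hom (lbprod _) (lbprod _)) \o
    strict_tenH (idm (lbprod S)) f <->
  lam (lbprod S) \o (f \ot idm (lbprod S)) =
  rho (lbprod S) \o (idm (lbprod S) \ot f).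
Proof.
rewrite strict_lam_act strict_rho_act; split=> [|-> //].
exact: (iso_epi (f := iso_sym (lbprod_cat S S))).
Qed.

Lemma strict_swap_iso :
  is_iso ((isom (strict_lam S) : Hom (lbprod _) (lbprod _)) \o
    strict_tenH f (idm (lbprod S))) <->
  is_iso (lam (lbprod S) \o (f \ot idm (lbprod S))).
Proof.
rewrite strict_lam_act; split=> [h|h].
  rewrite -[X in is_iso X](comp_canV (lbprod_cat S S)).
  exact: is_iso_comp h (iso_isiso (lbprod_cat S S)).
exact: is_iso_comp h (iso_isiso (iso_sym (lbprod_cat S S))).
Qed.

End Idempotency.

(** * Transport of central idempotents *)

Definition strict_slice (u : slice (center_unit C)) :
    slice (center_unit (strict_monoidal C)) :=
  existT (fun x : center (strict_monoidal C) =>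
      @Hom (center (strict_monoidal C)) x (center_unit _))
    (strict_center_ob (cdom u))
    (exist _ (cmor u) ((is_central_strict_unit _).2 (cmor_central u))).

Definition lb_slice (w : slice (center_unit (strict_monoidal C))) :
    slice (center_unit C) :=
  existT (fun x : center C => @Hom (center C) x (center_unit C))
    (lb_center_ob (cdom w))
    (exist _ (cmor w : @Hom C (lbprod (cob (cdom w))) unitO)
      ((is_central_lb_unit _).1 (cmor_central w))).

Definition strict_ci (u : central_idempotent C) :
    central_idempotent (strictification C) :=
  @MkCentralIdempotent (strict_monoidal C) (strict_slice u)
    ((@strict_swap [:: cob (cdom u)] (cmor u)).2 (ci_swap u))
    ((@strict_swap_iso [:: cob (cdom u)] (cmor u)).2 (ci_iso u)).

Definition lb_ci (w : central_idempotent (strictification C)) :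
    central_idempotent C :=
  @MkCentralIdempotent C (lb_slice w)
    ((@strict_swap (cob (cdom w)) (cmor w)).1 (ci_swap w))
    ((@strict_swap_iso (cob (cdom w)) (cmor w)).1 (ci_iso w)).

(** The same [f] serves on both sides, as morphisms between one-term sequences are those of [C]. *)
Lemma strict_ci_le (u v : central_idempotent C) :
  ci_le (strict_ci u) (strict_ci v) <-> ci_le u v.
Proof.
split=> /ci_leE[f cf vf]; apply: ci_leP; exists f => //.
  exact/is_central_strict.
exact/is_central_strict.
Qed.

(** The round trip replaces a sequence [S] by [[:: lbprod S]]. The identity of [lbprod S] is an
    isomorphism between them, central because the two half-braidings agree at one-term sequences. *)
Lemma lb_ciK (w : central_idempotent (strictification C)) :
  ci_eqv (strict_ci (lb_ci w)) w.
Proof.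
pose f : Hom (lbprod (cob (cdom w))) (lbprod (cob (cdom w))) := idm _.
apply/ci_eqvE; split; apply: ci_leP; exists f; try exact: compm1.
  apply/is_central_lb => A.
  by rewrite strict_half_braidingK !tenH_id comp1m compm1.
apply/is_central_lb => A.
by rewrite strict_half_braidingK !tenH_id comp1m compm1.
Qed.

(** * The order isomorphism on classes *)

Definition ZI_strict (x : ZI C) : ZI (strictification C) :=
  \pi_(ZI (strictification C)) (strict_ci (repr x)).

Definition ZI_lb (y : ZI (strictification C)) : ZI C :=
  \pi_(ZI C) (lb_ci (repr y)).

Lemma ZI_strict_mono : {mono ZI_strict : x y / (x <= y)%O}.
Proof.
move=> x y; rewrite /Order.le /= /ZI_strict ZI_le_pi.
by apply: asbool_equiv_eq; apply: strict_ci_le.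
Qed.

Lemma ZI_lbK : cancel ZI_lb ZI_strict.
Proof.
move=> y; rewrite /ZI_strict /ZI_lb -[RHS]reprK; apply/eqP/ZI_eqP/ci_eqvE.
(* The chosen representative is only equivalent to [lb_ci (repr y)]; monotonicity of [strict_ci]
   absorbs the difference. *)
have /ci_eqvE[l r] := ci_eqv_repr (lb_ci (repr y)).
have /ci_eqvE[l' r'] := lb_ciK (repr y).
split; first by apply: ci_le_trans l'; apply/strict_ci_le.
by apply: (ci_le_trans r'); apply/strict_ci_le.
Qed.

End HalfBraidingTransport.

Theorem corollary4p11 (C : BraidedMonoidalCategory) :
  exists f : ZI C -> ZI (strictification C),
    [/\ bijective f,
        {mono f : u v / (u <= v)%O},
        {morph f : u v / (u `&` v)%O}
      & f \top%O = \top%O].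
Proof.
have lbK := @ZI_lbK C; have mono := @ZI_strict_mono C.
have inj : injective (@ZI_strict C) := inc_inj mono.
exists (@ZI_strict C); split=> [|//|u v|].
(* A right inverse of an injection is also a left inverse. *)
- by exists (@ZI_lb C) => // u; apply: inj; rewrite lbK.
(* One inequality is monotonicity; for the other, the meet of the images is itself an image by
   [lbK], and [mono] reflects the order. *)
- apply/le_anti; rewrite lexI !mono leIl leIr /=.
  by rewrite -[leLHS]lbK mono lexI -!mono lbK leIl leIr.
(* The top is an image, hence lies below the image of the top. *)
- by apply/le_anti; rewrite lex1 -[leLHS]lbK mono lex1.
Qed.
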